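(* Let $\mathbb{F}_q$ be a finite field, let $f \in \mathbb{F}_q[X]$ be a non-zero polynomial with $d=\deg(f)$, let $c \in \mathbb{F}_q^\times$ be such that $c^2\neq 1$, let $a\in\mathbb{F}_q^\times$ and $b\in\mathbb{F}_q$, and let $$F_1 = f(z)-c\cdot f(x)-b,\qquad F_2 = c\cdot f(z+a)-f(x+a)-c\cdot b$$ in $\mathbb{F}_q[x,z]$ be the $c$-Boomerang polynomials of $(a,b)$. Then (1) $\{F_1,\ c^{-1}\cdot F_2-F_1\}$ is a DRL Gröbner basis of the ideal $(F_1,F_2)$ for $z >_{DRL} x$. (2) ${}_c\mathcal{B}_f(a,b)\leq d^2$.
   Context: $\mathbb{F}_q$ is the finite field with $q$ elements, $\mathbb{F}_q^\times=\mathbb{F}_q\setminus\{0\}$. For $c\in\mathbb{F}_q^\times$, a function $F:\mathbb{F}_q\to\mathbb{F}_q$ and $a,b\in\mathbb{F}_q$, $${}_c\mathcal{B}_F(a,b)=\left|\{(x,y)\in\mathbb{F}_q^2 \mid F(x+y)-c\cdot F(x)=b,\ \ c\cdot F(x+y+a)-F(x+a)=c\cdot b\}\right|.$$ The polynomials $F_1,F_2$ arise from these equations via $z=x+y$; a polynomial is identified with the function it induces. DRL is the degree reverse lexicographic term order: for exponent vectors, $\mathbf{a}>_{DRL}\mathbf{b}$ if $\sum a_i>\sum b_i$, or $\sum a_i=\sum b_i$ and the rightmost non-zero entry of $\mathbf{a}-\mathbf{b}$ is negative; here exponent vectors are written with the exponent of $z$ first and that of $x$ second. A finite subset $\mathcal{G}$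 of an ideal $I$ is a Gröbner basis of $I$ if the ideal generated by the leading monomials of the non-zero elements of $\mathcal{G}$ equals the ideal generated by the leading monomials of all non-zero elements of $I$. *)

(* Defs.v *)
From HB Require Import structures.
From mathcomp Require Import all_boot all_order all_algebra.
From mathcomp Require Import freeg mpoly.

Set Implicit Arguments.
Unset Strict Implicit.
Unset Printing Implicit Defensive.

Import GRing.Theory.

Local Open Scope ring_scope.

(* Degree reverse lexicographic order, with 'X_0 > 'X_1 > ... .  It is defined
   here because the canonical order of 'X_{1..n} (hence [mlead]), although
   documented as degrevlex, compares total degrees and then exponents
   lexicographically from the left. *)
Definition drl_lt n (m1 m2 : 'X_{1..n}) : bool :=
  (mdeg m1 < mdeg m2)%N
  || (mdeg m1 == mdeg m2)
     && [exists i : 'I_n,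
           (m2 i < m1 i)%N && [forall j : 'I_n, (i < j)%N ==> (m2 j == m1 j)]].

Definition drl_max n (m1 m2 : 'X_{1..n}) : 'X_{1..n} :=
  if drl_lt m1 m2 then m2 else m1.

(* 0%MM is the least monomial, so it does not affect the maximum when p != 0. *)
Definition drl_lead n (R : nzRingType) (p : {mpoly R[n]}) : 'X_{1..n} :=
  \big[@drl_max n/0%MM]_(m <- msupp p) m.

Definition ideal_gen (A : comNzRingType) (S : A -> Prop) (p : A) : Prop :=
  exists s : seq (A * A),
    (forall u, u \in s -> S u.2) /\ p = \sum_(u <- s) u.1 * u.2.

Definition drl_lead_monomials n (R : comNzRingType) (S : {mpoly R[n]} -> Prop)
    (p : {mpoly R[n]}) : Prop :=
  exists g : {mpoly R[n]}, [/\ S g, g != 0 & p = 'X_[drl_lead g]].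

Definition drl_groebner_basis n (K : fieldType)
    (G : seq {mpoly K[n]}) (I : {mpoly K[n]} -> Prop) : Prop :=
  (forall g, g \in G -> I g) /\
  (forall p, ideal_gen (drl_lead_monomials (fun g => g \in G)) p <->
             ideal_gen (drl_lead_monomials I) p).

(* z comes first in exponent vectors, so that z > x. *)
Definition var_z (R : nzRingType) : {mpoly R[2]} := 'X_(ord0 : 'I_2).
Definition var_x (R : nzRingType) : {mpoly R[2]} := 'X_(ord_max : 'I_2).

Definition poly_at n (R : nzRingType) (f : {poly R}) (t : {mpoly R[n]}) :
    {mpoly R[n]} :=
  (map_poly (@mpolyC n R) f).[t].

Definition cboomerang_poly1 (R : nzRingType) (f : {poly R}) (c b : R) :
    {mpoly R[2]} :=
  poly_at f (var_z R) - c *: poly_at f (var_x R) - b%:MP.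

Definition cboomerang_poly2 (R : nzRingType) (f : {poly R}) (c a b : R) :
    {mpoly R[2]} :=
  c *: poly_at f (var_z R + a%:MP) - poly_at f (var_x R + a%:MP) - (c * b)%:MP.

Definition cboomerang_count (F : finFieldType) (c : F) (f : F -> F) (a b : F) :
    nat :=
  #|[set u : F * F | (f (u.1 + u.2) - c * f u.1 == b)
                  && (c * f (u.1 + u.2 + a) - f (u.1 + a) == c * b)]|.

(* Main.v *)
Require Import Defs.
From HB Require Import structures.
From mathcomp Require Import all_boot all_order all_algebra.
From mathcomp Require Import freeg mpoly.
From mathcomp Require Import finfield ring.

Set Implicit Arguments.
Unset Strict Implicit.

Import GRing.Theory.

Local Open Scope ring_scope.

(** Write l for the leading coefficient of f.  In G2 = c^-1 F2 - F1 the terms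
    f(z + a) and - f(z) have the same leading term, so z^d cancels, while the
    two terms in x leave the leading coefficient (c - c^-1) l of x^d, nonzero
    because c^2 != 1.  Thus G2 agrees with (c - c^-1) l x^d up to degree < d,
    and so does F1 with l z^d - c l x^d if d > 0, when the constant b also has
    degree < d.  Therefore the ideal (F1, F2) has generators P = z^d + r1 and Q = x^d + r2 with r1, r2 of
    degree < d ([cboomerang_ideal_generators]); when d = 0, G2 is a nonzero
    constant and P = Q = 1 will do.

    (1) The monomials z^d and x^d are coprime, so Buchberger's first criterion
    applies to P and Q.  [coprime_lead_ideal] proves the consequence that
    matters: every monomial of top degree in an element of the ideal is
    divisible by z^d or x^d.  DRL compares total degrees first, so this covers
    the leading monomial.  Conversely z^d and x^d are leading monomials of F1
    and G2, or both equal to the leading monomial 1 of G2 if d = 0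
    ([cboomerang_drl_leads]).

    (2) Rewriting z^d to - r1 and x^d to - r2 lowers the degree, so every
    polynomial agrees on the set V of common zeros with a combination of the
    d^2 monomials z^i x^j, i, j < d ([staircase_span]).  Over a finite field
    every function on V is polynomial; counting functions on V and coefficient
    matrices gives q^#|V| <= q^(d^2) ([card_common_zeros]).  The change of
    variables z = x + y injects the solutions counted by the boomerang entry
    into V. *)

(** * Supports and degrees of multivariate polynomials *)

Lemma msize_leP n (R : nzRingType) (p : {mpoly R[n]}) N :
  reflect {in msupp p, forall m, (mdeg m < N)%N} (msize p <= N)%N.
Proof.
rewrite mmeasureE; apply: (iffP (bigmax_leqP_seq _ _ _ _)) => [h m mp|h m mp _].
  exact: h.
exact: h.
Qed.

Lemma msizeD_leq n (R : nzRingType) (p q : {mpoly R[n]}) N :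
  (msize p <= N)%N -> (msize q <= N)%N -> (msize (p + q) <= N)%N.
Proof.
by move=> hp hq; apply: leq_trans (msizeD_le _ _) _; rewrite geq_max hp.
Qed.

Lemma msizeZ_leq n (R : nzRingType) (p : {mpoly R[n]}) c N :
  (msize p <= N)%N -> (msize (c *: p) <= N)%N.
Proof. exact: leq_trans (msizeZ_le _ _). Qed.

(** A predicate separating the two supports rules out cancellation in the sum,
    so degree bounds on a sum pass to its summands. *)
Lemma msuppD_disjoint n (R : nzRingType) (p q : {mpoly R[n]})
    (C : pred 'X_{1..n}) :
  {in msupp p, forall m, C m} -> {in msupp q, forall m, ~~ C m} ->
  {subset msupp p <= msupp (p + q)} /\ {subset msupp q <= msupp (p + q)}.
Proof.
move=> hp hq; split=> m hm; move: (hm); rewrite !mcoeff_msupp mcoeffD.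
  suff /memN_msupp_eq0 ->: m \notin msupp q by rewrite addr0.
  by apply/negP=> /hq; rewrite hp.
suff /memN_msupp_eq0 ->: m \notin msupp p by rewrite add0r.
by apply/negP=> /hp; apply/negP/hq.
Qed.

Lemma msuppMX_lem n (R : nzRingType) (p : {mpoly R[n]}) v m :
  m \in msupp (p * 'X_[v]) -> (v <= m)%MM.
Proof. by rewrite (perm_mem (msuppMX _ _)) => /mapP[k _ ->]; apply: lem_addr. Qed.

Lemma mpoly_monomial_division n (R : nzRingType) (v : 'X_{1..n})
    (p : {mpoly R[n]}) :
  exists q r, p = q * 'X_[v] + r /\ {in msupp r, forall m, ~~ (v <= m)%MM}.
Proof.
exists (\sum_(m <- msupp p | (v <= m)%MM) p@_m *: 'X_[m - v]).
exists (\sum_(m <- msupp p | ~~ (v <= m)%MM) p@_m *: 'X_[m]); split.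
  rewrite [LHS]mpolyE (bigID (fun m => (v <= m)%MM)) /= mulr_suml.
  congr (_ + _); apply: eq_bigr => m vm.
  by rewrite -scalerAl -mpolyXD submK.
move=> m /msupp_sum_le /flattenP[s /mapP[k]]; rewrite mem_filter => /andP[vk _].
by move=> -> /msuppZ_le; rewrite msuppX mem_seq1 => /eqP->.
Qed.

(** Replacing the factor X^u by a polynomial r of degree < |u| lowers the degree
    bound by one.  The bound is on p * X^u and not on the sum of the degrees of
    p and X^u, so that p = 0 is allowed for every N. *)
Lemma msizeM_lower n (R : idomainType) (p r : {mpoly R[n]}) u N :
  (msize r <= mdeg u)%N -> (msize (p * 'X_[u]) <= N.+1)%N ->
  (msize (p * r) <= N)%N.
Proof.
have [-> _ _|p0 hr] := eqVneq p 0; first by rewrite mul0r msize0.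
have [->|r0] := eqVneq r 0; first by rewrite mulr0 msize0.
have X0 : 'X_[u] != 0 :> {mpoly R[n]} by rewrite -msize_poly_eq0 msizeX.
rewrite !msizeM // msizeX addnS /=; move: hr.
rewrite -(leq_add2l (msize p)) => h1 h2; have := leq_trans h1 h2.
by case: (_ + _)%N.
Qed.

(** * Ideals whose generators have coprime top monomials *)

Lemma lem_coprime n (u v m : 'X_{1..n}) :
  (forall i, u i = 0%N \/ v i = 0%N) -> (v <= u + m)%MM = (v <= m)%MM.
Proof.
move=> uv; apply/mnm_lepP/mnm_lepP => h i; have := h i; rewrite mnmDE.
  by case: (uv i) => ->.
by move=> hi; apply: leq_trans hi (leq_addl _ _).
Qed.

(** The top parts of A (X^u + r1) + B (X^v + r2) either survive, and then all
    monomials of top degree come from A X^u + B X^v, or cancel.  In the latter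
    case divide A by X^v: A = Q X^v + S.  Coprimality keeps S X^u and the
    multiples of X^v apart, so both parts of
      A X^u + B X^v = S X^u + (B + Q X^u) X^v
    have small degree.  The coefficients A - Q (X^v + r2) and B + Q (X^u + r1)
    represent the same element, and their terms have smaller degree.  Hence the
    induction on a degree bound N for both terms. *)
Lemma coprime_lead_ideal n (R : idomainType) (u v : 'X_{1..n})
    (r1 r2 A B : {mpoly R[n]}) m :
  (forall i, u i = 0%N \/ v i = 0%N) ->
  (msize r1 <= mdeg u)%N -> (msize r2 <= mdeg v)%N ->
  let g := A * ('X_[u] + r1) + B * ('X_[v] + r2) in
  m \in msupp g -> (mdeg m).+1 = msize g -> (u <= m)%MM || (v <= m)%MM.
Proof.
move=> uv hr1 hr2.
pose N := maxn (msize (A * 'X_[u])) (msize (B * 'X_[v])).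
have : (msize (A * 'X_[u]) <= N)%N by rewrite leq_maxl.
have : (msize (B * 'X_[v]) <= N)%N by rewrite leq_maxr.
move: N => N; elim: N A B => [|N IH] A B hB hA g mg sg.
  have X0 w : 'X_[w] != 0 :> {mpoly R[n]} by rewrite -msize_poly_eq0 msizeX.
  move: mg; rewrite /g; move: hA hB.
  rewrite !leqn0 !msize_poly_eq0 !mulf_eq0 !(negPf (X0 _)) !orbF.
  by move=> /eqP-> /eqP->; rewrite !mul0r addr0 msupp0.
pose T := A * 'X_[u] + B * 'X_[v].
have hAr : (msize (A * r1) <= N)%N by apply: msizeM_lower hA.
have hBr : (msize (B * r2) <= N)%N by apply: msizeM_lower hB.
have Tsupp k : k \in msupp T -> (u <= k)%MM || (v <= k)%MM.
  by move=> /msuppD_le; rewrite mem_cat => /orP[] /msuppMX_lem ->; rewrite ?orbT.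
(* In degree at least N only T contributes to g. *)
have gT k : (N <= mdeg k)%N -> (k \in msupp g) = (k \in msupp T).
  move=> Nk; have -> : g = T + (A * r1 + B * r2) by rewrite /g /T; ring.
  rewrite !mcoeff_msupp !mcoeffD.
  rewrite [(A * r1)@__]memN_msupp_eq0; last exact/msize_mdeg_ge/(leq_trans hAr).
  rewrite [(B * r2)@__]memN_msupp_eq0; last exact/msize_mdeg_ge/(leq_trans hBr).
  by rewrite !addr0.
case: (leqP (msize T) N) => [hT|NT]; last first.
  suff Nm : (N <= mdeg m)%N by rewrite Tsupp // -gT.
  rewrite leqNgt; apply/negP => mN.
  move: NT; rewrite ltnNge => /negP; apply; apply/msize_leP => k kT.
  rewrite ltnNge; apply/negP => Nk; move: kT; rewrite -gT // => /msize_mdeg_lt.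
  by rewrite -sg ltnS leqNgt (leq_trans mN Nk).
have [Q [S [AE hS]]] := mpoly_monomial_division v A.
have TE : T = (B + Q * 'X_[u]) * 'X_[v] + S * 'X_[u] by rewrite /T AE; ring.
have disj k : k \in msupp (S * 'X_[u]) -> ~~ (v <= k)%MM.
  rewrite (perm_mem (msuppMX _ _)) => /mapP[l /hS vl ->].
  by rewrite lem_coprime.
have [hBX hSX] : (msize ((B + Q * 'X_[u]) * 'X_[v]) <= N)%N
    /\ (msize (S * 'X_[u]) <= N)%N.
  have [s1 s2] := msuppD_disjoint (@msuppMX_lem _ _ (B + Q * 'X_[u]) v) disj.
  by split; apply/msize_leP => k kp; move/msize_leP: hT; apply; rewrite TE;
     [apply: s1 | apply: s2].
have hQ : (msize (Q * 'X_[u] * 'X_[v]) <= N.+1)%N.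
  have [s1 _] := msuppD_disjoint (@msuppMX_lem _ _ (Q * 'X_[u]) v) disj.
  apply/msize_leP => k /s1 kp; move/msize_leP: hA; apply.
  by move: kp; congr (_ \in msupp _); rewrite AE; ring.
have gE : g = (S - Q * r2) * ('X_[u] + r1)
            + (B + Q * 'X_[u] + Q * r1) * ('X_[v] + r2).
  by rewrite /g AE; ring.
apply: (IH (S - Q * r2) (B + Q * 'X_[u] + Q * r1)).
- rewrite mulrDl; apply: msizeD_leq hBX _.
  have -> : Q * r1 * 'X_[v] = Q * 'X_[v] * r1 by ring.
  apply: (msizeM_lower hr1).
  by move: hQ; congr (msize _ <= _)%N; ring.
- rewrite mulrBl; apply: msizeD_leq hSX _; rewrite msizeN.
  have -> : Q * r2 * 'X_[u] = Q * 'X_[u] * r2 by ring.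
  exact: (msizeM_lower hr2).
- by rewrite -gE.
- by rewrite -gE.
Qed.

(** Rewriting X^u to - r1 and X^v to - r2 terminates because it lowers the
    degree.  W is meant to be a linear subspace containing the ideal generated
    by X^u + r1 and X^v + r2. *)
Lemma staircase_span n (R : nzRingType) (u v : 'X_{1..n}) (r1 r2 : {mpoly R[n]})
    (W : {mpoly R[n]} -> Prop) :
  (msize r1 <= mdeg u)%N -> (msize r2 <= mdeg v)%N ->
  (forall p q, W p -> W q -> W (p + q)) -> (forall a p, W p -> W (a *: p)) ->
  (forall p, W (p * ('X_[u] + r1))) -> (forall p, W (p * ('X_[v] + r2))) ->
  (forall m, ~~ (u <= m)%MM -> ~~ (v <= m)%MM -> W 'X_[m]) ->
  forall p, W p.
Proof.
move=> hr1 hr2 WD WZ Wu Wv WX.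
have W0 : W 0 by rewrite -(mul0r ('X_[u] + r1)).
have Wsupp p : {in msupp p, forall m, W 'X_[m]} -> W p.
  move=> h; rewrite [p]mpolyE big_seq; elim/big_ind: _ => // m mp.
  exact/WZ/h.
have step w r m : (msize r <= mdeg w)%N -> (forall p, W (p * ('X_[w] + r))) ->
    (w <= m)%MM -> (forall k, (mdeg k < mdeg m)%N -> W 'X_[k]) -> W 'X_[m].
  move=> hr Ww wm IH.
  have -> : 'X_[m] = 'X_[m - w] * ('X_[w] + r) + (-1) *: ('X_[m - w] * r).
    by rewrite mulrDr -mpolyXD submK // scaleN1r addrK.
  apply: WD => //; apply/WZ/Wsupp => k /msuppM_le; rewrite msuppX.
  move=> /allpairsP[[k1 k2] /= []]; rewrite mem_seq1 => /eqP-> /msize_mdeg_lt k2r ->.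
  by apply: IH; rewrite -{2}(submK wm) !mdegD ltn_add2l (leq_trans k2r hr).
have WXall N m : (mdeg m < N)%N -> W 'X_[m].
  elim: N m => // N IH m; rewrite ltnS => mN.
  have IHm k : (mdeg k < mdeg m)%N -> W 'X_[k] by move=> km; apply/IH/leq_trans/mN.
  have [um|um] := boolP (u <= m)%MM; first exact: step hr1 Wu um IHm.
  have [vm|vm] := boolP (v <= m)%MM; first exact: step hr2 Wv vm IHm.
  exact: WX.
by move=> p; apply: Wsupp => m _; apply: (WXall (mdeg m).+1).
Qed.

(** * The DRL leading monomial *)

Lemma drl_lt_asym n (m1 m2 : 'X_{1..n}) : drl_lt m1 m2 -> ~~ drl_lt m2 m1.
Proof.
move=> /orP[lt12|/andP[/eqP eq12 /existsP[i /andP[lti /forallP eqi]]]].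
  by rewrite negb_or -leqNgt ltnW //= gtn_eqF.
rewrite negb_or eq12 ltnn eqxx /=; apply/existsPn => j; apply/negP.
move=> /andP[ltj /forallP eqj]; case: (ltngtP i j) => [ij|ji|/val_inj ij].
- by have := eqi j; rewrite ij => /eqP E; rewrite E ltnn in ltj.
- by have := eqj i; rewrite ji => /eqP E; rewrite E ltnn in lti.
- by move: ltj; rewrite -ij ltnNge ltnW.
Qed.

Lemma drl_max_mdeg n (m1 m2 : 'X_{1..n}) :
  mdeg (drl_max m1 m2) = maxn (mdeg m1) (mdeg m2).
Proof.
rewrite /drl_max /drl_lt; case: ltngtP => //=; last by case: ifP => _ ->.
Qed.

(** DRL refines the total degree, and this is all that the divisibility argument
    needs to know about the leading monomial. *)
Lemma drl_lead_mdeg n (R : nzRingType) (p : {mpoly R[n]}) :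
  p != 0 -> (mdeg (drl_lead p)).+1 = msize p.
Proof.
move=> p0; rewrite mmeasureE /drl_lead.
have : msupp p != [::] by rewrite msupp_eq0.
elim: (msupp p) => // m s IH _; rewrite !big_cons drl_max_mdeg.
have [->|/IH <-] := eqVneq s [::]; last by rewrite maxnSS.
by rewrite !big_nil mdeg0 maxn0.
Qed.

(** The big maximum starts from the default value 0, so the case of a leading
    monomial 0 needs care: p is then a constant, and 0 is in its support. *)
Lemma drl_lead_supp n (R : nzRingType) (p : {mpoly R[n]}) :
  p != 0 -> drl_lead p \in msupp p.
Proof.
move=> p0; have : drl_lead p \in 0%MM :: msupp p.
  rewrite /drl_lead; elim: (msupp p) => [|m s IH]; first by rewrite big_nil mem_head.
  rewrite big_cons {1}/drl_max; case: ifP => _; last by rewrite !inE eqxx orbT.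
  by move: IH; rewrite !inE => /orP[->//|->]; rewrite !orbT.
rewrite inE => /orP[/eqP l0|//].
rewrite l0; have := mlead_supp p0; have := mlead_deg p0.
by rewrite -drl_lead_mdeg // l0 mdeg0 => -[/eqP]; rewrite mdeg_eq0 => /eqP->.
Qed.

Lemma drl_leadP n (R : nzRingType) (p : {mpoly R[n]}) m0 :
  m0 \in msupp p -> (forall m, m \in msupp p -> m != m0 -> drl_lt m m0) ->
  drl_lead p = m0.
Proof.
move=> m0p hp.
have h0 : 0%MM != m0 -> drl_lt 0%MM m0.
  by rewrite eq_sym /drl_lt mdeg0 lt0n mdeg_eq0 => ->.
have maxl m : (m != m0 -> drl_lt m m0) -> drl_max m m0 = m0.
  by rewrite /drl_max; case: eqP => [->|_ ->//]; rewrite if_same.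
have maxr m : (m != m0 -> drl_lt m m0) -> drl_max m0 m = m0.
  rewrite /drl_max; case: eqP => [->|_ /(_ isT)/drl_lt_asym/negPf->//].
  by rewrite if_same.
(* m0 need not occur in a tail of the support, where the maximum is only
   known to lie at or below m0. *)
suff : forall s, {subset s <= msupp p} ->
    let M := \big[@drl_max n/0%MM]_(m <- s) m in
    (M != m0 -> drl_lt M m0) /\ (m0 \in s -> M = m0).
  by move=> /(_ (msupp p) (fun _ => id)) [_]; apply.
elim=> [_|m s IH hs] /=; first by rewrite big_nil.
have [IH1 IH2] := IH (fun k ks => hs k (@mem_behead _ (m :: s) k ks)).
have hm : m != m0 -> drl_lt m m0 by apply/hp/hs/mem_head.
rewrite big_cons; split.
  rewrite /drl_max; case: ifP => _; [exact: IH1 | exact: hm].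
rewrite inE => /orP[/eqP<-|/IH2 ->]; [exact: maxr | exact: maxl].
Qed.

Lemma drl_lt_msize n (R : nzRingType) (r : {mpoly R[n]}) m0 :
  (msize r <= mdeg m0)%N -> {in msupp r, forall m, drl_lt m m0}.
Proof. by move=> hr m /msize_mdeg_lt mr; rewrite /drl_lt (leq_trans mr hr). Qed.

Lemma drl_lead_monomialD n (R : nzRingType) k m0 (q : {mpoly R[n]}) :
  k != 0 -> {in msupp q, forall m, drl_lt m m0} ->
  k *: 'X_[m0] + q != 0 /\ drl_lead (k *: 'X_[m0] + q) = m0.
Proof.
move=> k0 hq.
have m0p : m0 \in msupp (k *: 'X_[m0] + q).
  rewrite mcoeff_msupp mcoeffD mcoeffZ mcoeffX eqxx mulr1.
  rewrite [q@_m0]memN_msupp_eq0 ?addr0 //; apply/negP => /hq lt00.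
  by have := drl_lt_asym lt00; rewrite lt00.
split; first by apply: contraTneq m0p => ->; rewrite msupp0.
apply: drl_leadP => // m /msuppD_le; rewrite mem_cat => /orP[/msuppZ_le|/hq //].
by rewrite msuppX mem_seq1 => ->.
Qed.

(** * Generated ideals *)

Lemma ideal_gen_trans (A : comNzRingType) (S T : A -> Prop) :
  (forall u, S u -> ideal_gen T u) -> forall p, ideal_gen S p -> ideal_gen T p.
Proof.
move=> ST p [s [hs ->]]; elim: s hs => [|u s IH] hs.
  by exists [::]; rewrite !big_nil.
have [t [ht tE]] := IH (fun w ws => hs w (@mem_behead _ (u :: s) w ws)).
have [r [hr rE]] := ST _ (hs u (mem_head _ _)).
exists ([seq (u.1 * w.1, w.2) | w <- r] ++ t); split.
  by move=> w; rewrite mem_cat => /orP[/mapP[k kr ->]|/ht//]; apply: (hr k).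
rewrite big_cons big_cat big_map /= tE rE mulr_sumr; congr (_ + _).
by apply: eq_bigr => w _; rewrite mulrA.
Qed.

Lemma mem_ideal_gen (A : comNzRingType) (S : A -> Prop) q p :
  S p -> ideal_gen S (q * p).
Proof.
move=> Sp; exists [:: (q, p)]; rewrite big_seq1; split=> // u.
by rewrite mem_seq1 => /eqP->.
Qed.

Lemma ideal_gen_pairP (A : comNzRingType) (p q r : A) :
  ideal_gen (fun u => u \in [:: p; q]) r <-> exists a b, r = a * p + b * q.
Proof.
split=> [[s [hs ->]]|[a [b ->]]].
  elim: s hs => [|u s IH] hs.
    by exists 0, 0; rewrite big_nil !mul0r addr0.
  have [a [b E]] := IH (fun w ws => hs w (@mem_behead _ (u :: s) w ws)).
  have := hs u (mem_head _ _); rewrite big_cons E !inE => /orP[] /eqP->.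
    by exists (u.1 + a), b; ring.
  by exists a, (u.1 + b); ring.
exists [:: (a, p); (b, q)]; rewrite big_cons big_seq1; split=> // u.
by rewrite !inE => /orP[] /eqP->; rewrite eqxx ?orbT.
Qed.

(** * Substituting variables into a univariate polynomial *)

Lemma poly_at_var n (R : nzRingType) (f : {poly R}) (i : 'I_n) :
  f != 0 ->
  exists r, (msize r <= (size f).-1)%N /\
    poly_at f 'X_i = lead_coef f *: 'X_[U_(i) *+ (size f).-1] + r.
Proof.
move=> f0; have : (0 < size f)%N by rewrite size_poly_gt0.
have szf : (size (map_poly (@mpolyC n R) f) <= size f)%N by apply: size_poly.
rewrite /poly_at lead_coefE (horner_coef_wide _ szf).
case E : (size f) => [//|d] _; rewrite big_ord_recr /= addrC.
exists (\sum_(k < d) (map_poly (@mpolyC n R) f)`_k * 'X_i ^+ k); split.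
  apply/msize_leP => m /msupp_sum_le /flattenP[s /mapP[k _ ->]].
  rewrite /= coef_map_id0 ?mpolyC0 // mpolyXn mul_mpolyC => /msuppZ_le.
  by rewrite msuppX mem_seq1 => /eqP->; rewrite mdegMn mdeg1 mul1n.
by rewrite coef_map_id0 ?mpolyC0 // mpolyXn mul_mpolyC.
Qed.

Lemma poly_at_shift n (R : comNzRingType) (f : {poly R}) (a : R)
    (t : {mpoly R[n]}) :
  poly_at f (t + a%:MP) = poly_at (f \Po ('X + a%:P)) t.
Proof.
by rewrite /poly_at map_comp_poly horner_comp rmorphD /= map_polyX map_polyC /=
   hornerD hornerX hornerC.
Qed.

Lemma poly_at_meval n (R : comNzRingType) (f : {poly R}) (t : {mpoly R[n]}) v :
  (poly_at f t).@[v] = f.[t.@[v]].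
Proof.
rewrite /poly_at -horner_map -map_poly_comp /= map_poly_id // => x _ /=.
by rewrite mevalC.
Qed.

(** A shift by a constant changes neither the degree nor the leading
    coefficient of f. *)
Lemma poly_at_shifted_var n (R : idomainType) (f : {poly R}) (a : R) (i : 'I_n) :
  f != 0 ->
  exists r, (msize r <= (size f).-1)%N /\
    poly_at f ('X_i + a%:MP) = lead_coef f *: 'X_[U_(i) *+ (size f).-1] + r.
Proof.
move=> f0; have sX : size ('X + a%:P) = 2 by rewrite size_XaddC.
have lf : lead_coef (f \Po ('X + a%:P)) = lead_coef f.
  by rewrite lead_coef_comp ?sX // lead_coefXaddC expr1n mulr1.
have fX0 : f \Po ('X + a%:P) != 0 by rewrite -lead_coef_eq0 lf lead_coef_eq0.
have := poly_at_var i fX0; rewrite lf size_comp_poly2 // => -[r [hr E]].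
by exists r; rewrite poly_at_shift.
Qed.

(** * Powers of the two variables *)

Definition power_var (d : nat) (i : 'I_2) : 'X_{1..2} := (U_(i) *+ d)%MM.

Lemma mdeg_power_var d i : mdeg (power_var d i) = d.
Proof. by rewrite mdegMn mdeg1 mul1n. Qed.

Lemma power_var_lem d i (m : 'X_{1..2}) : (power_var d i <= m)%MM = (d <= m i)%N.
Proof.
apply/mnm_lepP/idP => [/(_ i)|h j]; rewrite mulmnE mnm1E; first by rewrite eqxx mul1n.
by case: eqP => [<-|_]; rewrite ?mul1n.
Qed.

(** Among monomials of equal degree the one with less x is the larger. *)
Lemma drl_lt_power_var d : (0 < d)%N ->
  drl_lt (power_var d ord_max) (power_var d ord0).
Proof.
move=> d0; rewrite /drl_lt !mdeg_power_var eqxx ltnn /=.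
apply/existsP; exists ord_max; rewrite !mulmnE !mnm1E eqxx mul1n mul0n d0 /=.
by apply/forallP => j; apply/implyP; rewrite ltnNge -ltnS ltn_ord.
Qed.

(** * Counting common zeros over a finite field *)

(** By Fermat, 1 - (X_i - w_i)^(q-1) is 1 where X_i = w_i and 0 elsewhere; the
    product over i is the indicator of the point w. *)
Lemma ffun_interpolation n (F : finFieldType) (g : {ffun 'I_n -> F} -> F) :
  exists p : {mpoly F[n]}, forall v : {ffun 'I_n -> F}, p.@[v] = g v.
Proof.
pose delta w : {mpoly F[n]} :=
  \prod_(i < n) (1 - ('X_i - (w i)%:MP) ^+ (#|F|.-1)).
have deltaE (w v : {ffun 'I_n -> F}) : (delta w).@[v] = (v == w)%:R.
  have factorE i : (1 - ('X_i - (w i)%:MP) ^+ (#|F|.-1) : {mpoly F[n]}).@[v]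
      = (v i == w i)%:R.
    rewrite mevalB meval1 rmorphXn /= mevalB mevalXU mevalC.
    have F1 := finNzRing_gt1 F; have F0 : (0 < #|F|.-1)%N by rewrite -subn1 subn_gt0.
    have [->|ne] := eqVneq; first by rewrite subrr expr0n gtn_eqF // subr0.
    have x0 : v i - w i != 0 by rewrite subr_eq0.
    apply/eqP; rewrite subr_eq0 eq_sym -(inj_eq (mulfI x0)) -exprS mulr1.
    by rewrite prednK ?expf_card //; apply: ltnW.
  rewrite rmorph_prod /= (eq_bigr _ (fun i _ => factorE i)).
  have [->|ne] := eqVneq; first by rewrite big1 // => i _; rewrite eqxx.
  have /existsP[i vi] : [exists i, v i != w i].
    by apply: contraNT ne => /existsPn h; apply/eqP/ffunP => i; apply/eqP/negPn/h.
  by rewrite (bigD1 i) //= (negPf vi) mul0r.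
exists (\sum_w g w *: delta w) => v; rewrite raddf_sum (bigD1 v) //= mevalZ.
rewrite deltaE eqxx mulr1 big1 ?addr0 // => w wv.
by rewrite mevalZ deltaE eq_sym (negPf wv) mulr0.
Qed.

(** Matrices of size d parametrize the combinations of the z^i x^j, i, j < d, so
    the restrictions of polynomials to V number at most q^(d^2).  By
    interpolation they are all the q^#|V| functions on V. *)
Lemma card_common_zeros (F : finFieldType) d (r1 r2 : {mpoly F[2]})
    (V : {set {ffun 'I_2 -> F}}) :
  (msize r1 <= d)%N -> (msize r2 <= d)%N ->
  (forall v : {ffun 'I_2 -> F}, v \in V -> ('X_[power_var d ord0] + r1).@[v] = 0) ->
  (forall v : {ffun 'I_2 -> F}, v \in V -> ('X_[power_var d ord_max] + r2).@[v] = 0) ->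
  (#|V| <= d ^ 2)%N.
Proof.
move=> hr1 hr2 V1 V2.
pose box (E : 'M[F]_d) (v : {ffun 'I_2 -> F}) :=
  \sum_i \sum_j E i j * (v ord0 ^+ i * v ord_max ^+ j).
have span (p : {mpoly F[2]}) :
    exists E, forall v : {ffun 'I_2 -> F}, v \in V -> p.@[v] = box E v.
  move: p; apply: (@staircase_span _ _ (power_var d ord0) (power_var d ord_max) r1 r2
    (fun p => exists E, forall v : {ffun 'I_2 -> F}, v \in V -> p.@[v] = box E v)).
  - by rewrite mdeg_power_var.
  - by rewrite mdeg_power_var.
  - move=> p q [E1 h1] [E2 h2]; exists (E1 + E2) => v vV.
    rewrite mevalD h1 // h2 // -big_split; apply: eq_bigr => i _.
    by rewrite -big_split; apply: eq_bigr => j _; rewrite mxE mulrDl.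
  - move=> a p [E h]; exists (a *: E) => v vV.
    rewrite mevalZ h // mulr_sumr; apply: eq_bigr => i _.
    by rewrite mulr_sumr; apply: eq_bigr => j _; rewrite mxE; apply: mulrA.
  - move=> p; exists 0 => v vV; rewrite mevalM V1 // mulr0 [RHS]big1 // => i _.
    by rewrite big1 // => j _; rewrite mxE mul0r.
  - move=> p; exists 0 => v vV; rewrite mevalM V2 // mulr0 [RHS]big1 // => i _.
    by rewrite big1 // => j _; rewrite mxE mul0r.
  move=> m; rewrite !power_var_lem -!ltnNge => m0 m1.
  exists (delta_mx (Ordinal m0) (Ordinal m1)) => v _.
  rewrite mevalX 2!big_ord_recl big_ord0 mulr1.
  rewrite /box (bigD1 (Ordinal m0)) //= (bigD1 (Ordinal m1)) //= mxE !eqxx mul1r.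
  rewrite [X in _ * _ + X]big1 => [|j /negPf jm]; last by rewrite mxE jm andbF mul0r.
  rewrite [X in _ + X]big1 => [|i /negPf im]; last first.
    by rewrite big1 // => j _; rewrite mxE im mul0r.
  by rewrite !addr0; congr (_ * _ ^+ m _); try congr (v _); apply/val_inj.
(* Functions on V are encoded as functions supported in V. *)
pose restrict E := [ffun v => if v \in V then box E v else 0].
have sub : {subset pffun_on 0 V predT <= codom restrict}.
  move=> g /pffun_onP[/subsetP gV _].
  have [p pg] := ffun_interpolation g; have [E hE] := span p.
  apply/codomP; exists E; apply/ffunP => v; rewrite ffunE.
  case: ifP => [vV|vV]; first by rewrite -hE // pg.
  by apply/eqP/negPn/negP => gv; rewrite (gV v) in vV.
have := leq_trans (subset_leq_card (introT subsetP sub)) (leq_image_card _ _).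
by rewrite card_pffun_on card_mx leq_exp2l ?finNzRing_gt1 // mulnn.
Qed.

(** * The boomerang polynomials *)

(** The constants b cancel in c^-1 F2 - F1, so its remainder is small even for
    d = 0; in F1 the constant b is small only for d > 0. *)
Lemma cboomerang_leading_terms (F : fieldType) (f : {poly F}) (c a b : F) :
  f != 0 -> c != 0 ->
  let F1 := cboomerang_poly1 f c b in
  let F2 := cboomerang_poly2 f c a b in
  let d := (size f).-1 in
  let l := lead_coef f in
  exists r1 r2, [/\ (0 < d -> msize r1 <= d)%N, (msize r2 <= d)%N,
    F1 = l *: 'X_[power_var d ord0]
         + (r1 - (c * l) *: 'X_[power_var d ord_max]) &
    c^-1 *: F2 - F1 = ((c - c^-1) * l) *: 'X_[power_var d ord_max] + r2].
Proof.
move=> f0 c0 F1 F2 d l.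
have [rz [hz Ez]] := poly_at_var (ord0 : 'I_2) f0.
have [rx [hx Ex]] := poly_at_var (ord_max : 'I_2) f0.
have [sz [gz Sz]] := poly_at_shifted_var a (ord0 : 'I_2) f0.
have [sx [gx Sx]] := poly_at_shifted_var a (ord_max : 'I_2) f0.
exists (rz - c *: rx - b%:MP), (sz - rz - c^-1 *: sx + c *: rx); split.
- move=> d0; rewrite -addrA; apply: msizeD_leq => //.
  rewrite -opprD msizeN; apply: msizeD_leq; first exact: msizeZ_leq.
  by rewrite msizeC; case: eqP => // _; apply: d0.
- by rewrite !(msizeD_leq, msizeN, msizeZ_leq).
- by rewrite /F1 /cboomerang_poly1 /var_z /var_x Ez Ex -!mul_mpolyC !mpolyCM; ring.
rewrite /F1 /F2 /cboomerang_poly1 /cboomerang_poly2 /var_z /var_x Ez Ex Sz Sx.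
have cc : c^-1%:MP * c%:MP = 1 :> {mpoly F[2]} by rewrite -mpolyCM mulVf.
rewrite -!mul_mpolyC !(mpolyCM, mpolyCB) !mulrBr !mulrDr !mulrA !cc.
by ring.
Qed.

(** When d = 0 both monomials are 1, and F1 may vanish; the nonzero constant
    c^-1 F2 - F1 then accounts for both. *)
Lemma cboomerang_drl_leads (F : fieldType) (f : {poly F}) (c a b : F) :
  f != 0 -> c != 0 -> c ^+ 2 != 1 ->
  let F1 := cboomerang_poly1 f c b in
  let F2 := cboomerang_poly2 f c a b in
  let d := (size f).-1 in
  forall i : 'I_2, drl_lead_monomials (fun g => g \in [:: F1; c^-1 *: F2 - F1])
                     'X_[power_var d i].
Proof.
move=> f0 c0 c2 F1 F2 d.
have [r1 [r2 []]] := cboomerang_leading_terms a b f0 c0.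
rewrite -/F1 -/F2 -/d => hr1 hr2 E1 E2.
have l0 : lead_coef f != 0 by rewrite lead_coef_eq0.
have s0 : (c - c^-1) * lead_coef f != 0.
  by rewrite mulf_neq0 // subr_eq0 -(inj_eq (mulfI c0)) mulfV // -expr2.
have [G0 GE] := drl_lead_monomialD s0
  (@drl_lt_msize _ _ r2 (power_var d ord_max) ltac:(by rewrite mdeg_power_var)).
have lead_x : drl_lead_monomials (fun g => g \in [:: F1; c^-1 *: F2 - F1])
    'X_[power_var d ord_max].
  by exists (c^-1 *: F2 - F1); rewrite !inE eqxx orbT E2 GE.
move=> i; have [d0|] := posnP d.
  suff -> : power_var d i = power_var d ord_max by [].
  by apply/mnmP => j; rewrite !mulmnE d0 !muln0.
move=> d0; have [->|-> //] : i = ord0 \/ i = ord_max.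
  by case: i => -[|[|//]] lti; [left | right]; apply/val_inj.
have q1 : {in msupp (r1 - (c * lead_coef f) *: 'X_[power_var d ord_max]),
    forall m, drl_lt m (power_var d ord0)}.
  move=> m /msuppB_le; rewrite mem_cat => /orP[|/msuppZ_le].
    by apply: drl_lt_msize; rewrite mdeg_power_var hr1.
  by rewrite msuppX mem_seq1 => /eqP->; apply: drl_lt_power_var.
have [F10 F1E] := drl_lead_monomialD l0 q1.
by exists F1; rewrite !inE eqxx E1 F1E.
Qed.

(** Scaling c^-1 F2 - F1 gives x^d + r2, which then removes the x^d term from
    F1.  For d = 0 the remainders must vanish, so both generators are 1. *)
Lemma cboomerang_ideal_generators (F : fieldType) (f : {poly F}) (c a b : F) :
  f != 0 -> c != 0 -> c ^+ 2 != 1 ->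
  let F1 := cboomerang_poly1 f c b in
  let F2 := cboomerang_poly2 f c a b in
  let d := (size f).-1 in
  exists r1 r2, [/\ (msize r1 <= d)%N, (msize r2 <= d)%N &
    forall p, ideal_gen (fun u => u \in [:: F1; F2]) p <->
      exists A B, p = A * ('X_[power_var d ord0] + r1)
                    + B * ('X_[power_var d ord_max] + r2)].
Proof.
move=> f0 c0 c2 F1 F2 d.
have [r1 [r2 []]] := cboomerang_leading_terms a b f0 c0.
rewrite -/F1 -/F2 -/d; set l := lead_coef f; set s := (c - c^-1) * l.
set Z := 'X_[_]; set X := 'X_[_] => hr1 hr2 E1 E2.
have l0 : l != 0 by rewrite lead_coef_eq0.
have s0 : s != 0.
  by rewrite mulf_neq0 // subr_eq0 -(inj_eq (mulfI c0)) mulfV // -expr2.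
have constV (k : F) : k != 0 -> k^-1%:MP * k%:MP = 1 :> {mpoly F[2]}.
  by move=> k0; rewrite -mpolyCM mulVf.
have F2E : F2 = c%:MP * ((c^-1 *: F2 - F1) + F1).
  by rewrite subrK mul_mpolyC scalerA mulfV // scale1r.
pose t2 := s^-1 *: r2.
have QE : X + t2 = s^-1%:MP * (c^-1%:MP * F2 - F1).
  by rewrite mul_mpolyC (mul_mpolyC c^-1) E2 scalerDr scalerA mulVf // scale1r.
have QE' : c^-1 *: F2 - F1 = s%:MP * (X + t2).
  by rewrite QE mulrA [s%:MP * _]mulrC constV // mul1r mul_mpolyC.
have [d0|d_gt0] := posnP d.
  have pow0 i : power_var d i = 0%MM.
    by apply/mnmP => j; rewrite mulmnE d0 muln0 mnm0E.
  have Z1 : Z = 1 by rewrite /Z pow0 mpolyX0.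
  have X1 : X = 1 by rewrite /X pow0 mpolyX0.
  have r20 : r2 = 0 by move: hr2; rewrite d0 leqn0 msize_poly_eq0 => /eqP.
  exists 0, 0; rewrite msize0; split=> // p; split=> _.
    by exists p, 0; rewrite Z1 addr0 mulr1 mul0r addr0.
  apply/ideal_gen_pairP; exists (- p * s^-1%:MP), (p * s^-1%:MP * c^-1%:MP).
  move: QE; rewrite X1 /t2 r20 scaler0 addr0 => QE.
  by rewrite -[LHS]mulr1 QE; ring.
(* X + t2 carries the multiple of x^d to be added to F1, whence c *: t2. *)
pose t1 := l^-1 *: r1 + c *: t2.
have F1E : F1 = l%:MP * (Z + t1) - (c * l)%:MP * (X + t2).
  have -> : l%:MP * (Z + t1) = l *: Z + r1 + (c * l) *: t2.
    rewrite mul_mpolyC /t1 !scalerDr !scalerA mulfV // scale1r addrA.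
    by rewrite [l * c]mulrC.
  by rewrite E1 -!mul_mpolyC; ring.
have PE : Z + t1 = l^-1%:MP * (F1 + (c * l)%:MP * (X + t2)).
  by rewrite F1E subrK mulrA constV // mul1r.
exists t1, t2; split.
- by rewrite /t1 msizeD_leq // !msizeZ_leq // hr1.
- by rewrite msizeZ_leq.
move=> p; rewrite ideal_gen_pairP; split=> -[A [B ->]].
  exists (A * l%:MP + B * c%:MP * l%:MP).
  exists (B * c%:MP * s%:MP - (A + B * c%:MP) * (c * l)%:MP).
  by rewrite {1}F2E QE' F1E; ring.
pose k := A * l^-1%:MP * (c * l)%:MP + B.
exists (A * l^-1%:MP - k * s^-1%:MP), (k * s^-1%:MP * c^-1%:MP).
by rewrite PE QE /k; ring.
Qed.

Theorem proposition16 (F : finFieldType) (f : {poly F}) (c a b : F)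
    (f_neq0 : f != 0) (c_neq0 : c != 0) (c2_neq1 : c ^+ 2 != 1)
    (a_neq0 : a != 0) :
  let F1 := cboomerang_poly1 f c b in
  let F2 := cboomerang_poly2 f c a b in
  let d := (size f).-1 in
  drl_groebner_basis [:: F1; c^-1 *: F2 - F1]
    (ideal_gen (fun p => p \in [:: F1; F2]))
  /\ (cboomerang_count c (fun x => f.[x]) a b <= d ^ 2)%N.
Proof.
move=> F1 F2 d.
have [r1 [r2 []]] := cboomerang_ideal_generators a b f_neq0 c_neq0 c2_neq1.
rewrite -/F1 -/F2 -/d => hr1 hr2 IE.
have GI g : g \in [:: F1; c^-1 *: F2 - F1] ->
    ideal_gen (fun p => p \in [:: F1; F2]) g.
  rewrite !inE => /orP[] /eqP ->; apply/ideal_gen_pairP; first by exists 1, 0; ring.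
  by exists (- 1), c^-1%:MP; rewrite mul_mpolyC mulN1r addrC.
split.
  split=> // p; split; apply: ideal_gen_trans => {}p [g [gS g0 ->]].
    by rewrite -['X_[_]]mul1r; apply: mem_ideal_gen; exists g; split=> //; apply: GI.
  have [A [B gE]] := (IE g).1 gS.
  have leads := cboomerang_drl_leads a b f_neq0 c_neq0 c2_neq1.
  have div i : (power_var d i <= drl_lead g)%MM ->
      ideal_gen (drl_lead_monomials (fun g => g \in [:: F1; c^-1 *: F2 - F1]))
        'X_[drl_lead g].
    by move=> /submK <-; rewrite mpolyXD; apply/mem_ideal_gen/leads.
  suff /orP[] : (power_var d ord0 <= drl_lead g)%MM
             || (power_var d ord_max <= drl_lead g)%MM by apply: div.
  apply: (@coprime_lead_ideal _ _ _ _ r1 r2 A B).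
  - case=> -[|[|//]] lti; [right | left]; by rewrite mulmnE mnm1E.
  - by rewrite mdeg_power_var.
  - by rewrite mdeg_power_var.
  - by rewrite -gE drl_lead_supp.
  - by rewrite -gE drl_lead_mdeg.
rewrite /cboomerang_count; set S := [set u | _].
pose point (u : F * F) : {ffun 'I_2 -> F} :=
  [ffun i => if i == ord0 then u.1 + u.2 else u.1].
have point_inj : injective point.
  move=> [x y] [x' y'] /ffunP E; have := E ord_max; have := E ord0.
  by rewrite !ffunE /= => E0 E1; move: E0; rewrite E1 => /(@addrI _ _ _ _) ->.
have vanish p v : ideal_gen (fun u => u \in [:: F1; F2]) p -> v \in point @: S ->
    p.@[v] = 0.
  move=> /ideal_gen_pairP[A [B ->]] /imsetP[u]; rewrite inE => /andP[/eqP e1 /eqP e2 ->].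
  rewrite mevalD !mevalM /F1 /F2 /cboomerang_poly1 /cboomerang_poly2.
  rewrite !mevalB !mevalZ !poly_at_meval !mevalD !mevalXU !mevalC !ffunE /=.
  by rewrite e1 e2 !subrr !mulr0 addr0.
rewrite -(card_imset _ point_inj).
apply: (card_common_zeros hr1 hr2) => v; apply: vanish; apply/IE.
  by exists 1, 0; rewrite mul1r mul0r addr0.
by exists 0, 1; rewrite mul1r mul0r add0r.
Qed.
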